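(* There exists $\varepsilon_0\in(0,\tfrac12)$ such that for every $\varepsilon\in(0,\varepsilon_0)$ and every $d\in\mathbb{N}=\{1,2,\dots\}$, the information complexity of integration for the class $F_d^{\,\mathrm{con}}$ of convex functions satisfies $$n^{\mathrm{int}}(F_d^{\,\mathrm{con}},\varepsilon)\ \ge\ \frac{1}{d+1}\left(\frac{11}{10}\right)^d\left(1-\frac{\varepsilon}{\varepsilon_0}\right).$$ Thus, the integration problem for convex functions suffers from the curse of dimensionality.
   Context: For $d\in\mathbb{N}$, let $F_d^{\,\mathrm{con}}$ be the set of all convex functions $f:[0,1]^d\to[0,1]$. Let $\mathrm{INT}_d(f)=\int_{[0,1]^d}f(x)\,dx$. For an integer $n\ge 0$, an algorithm $A_n$ using $n$ function values has the form $A_n(f)=\phi_n(f(t_1),\dots,f(t_n))$, where $\phi_n:\mathbb{R}^n\to\mathbb{R}$ is an arbitrary mapping and the sample points $t_j\in[0,1]^d$ are arbitrary and may be chosen adaptively: $t_1$ is fixed and, for $j\ge2$, $t_j$ may depend (arbitrarily) on the already computed values $f(t_1),\dots,f(t_{j-1})$. For $n=0$, $A_0$ is a constant real number. For a class $F_d$ of such functions, the $n$th minimal worst case error is $$e_n^{\mathrm{int}}(F_d)=\inf_{A_n}\ \sup_{f\in F_d}|\mathrm{INT}_d(f)-A_n(f)|,$$ where the infimum is over all algorithms $A_n$ of the form $A_n(f)=\phi_n(f(t_1),\dots,f(t_n))$ with arbitrary $\phi_n:\mathbb{R}^n\to\mathbb{R}$ and arbitrary, possibly adaptively chosen, sample points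 $t_j\in[0,1]^d$ (over all real constants $A_0$ if $n=0$), and the information complexity is $$n^{\mathrm{int}}(F_d,\varepsilon)=\min\{n\in\{0,1,2,\dots\}: e_n^{\mathrm{int}}(F_d)\le\varepsilon\}.$$ The problem suffers from the curse of dimensionality if its information complexity is at least exponential in $d$ for some fixed $\varepsilon$, i.e. there exist $\varepsilon>0$, $c>0$ and $\gamma>1$ such that the information complexity at $\varepsilon$ is at least $c\,\gamma^d$ for all $d\in\mathbb{N}$. *)

(* Defs.v *)
From HB Require Import structures.
From mathcomp Require Import all_boot all_order all_algebra.
From mathcomp Require Import all_classical all_reals all_analysis.

Set Implicit Arguments.
Unset Strict Implicit.
Unset Printing Implicit Defensive.

Import Order.TTheory GRing.Theory Num.Theory.
Import numFieldNormedType.Exports.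

Local Open Scope classical_set_scope.
Local Open Scope ring_scope.

Definition measure_rV_display : measure_display -> measure_display.
Proof. exact. Qed.

(* The sigma-algebra generated by the coordinates; for T = R it is the Borel
   sigma-algebra of R^n. *)
Section measurable_rV.
Context {d} {T : measurableType d}.
Variable n : nat.

Definition coord_rV : 'I_n -> 'rV[T]_n -> T := fun i x => x ord0 i.

Let rV_set0 : g_sigma_preimage coord_rV set0.
Proof. exact: sigma_algebra0. Qed.

Let rV_setC A : g_sigma_preimage coord_rV A -> g_sigma_preimage coord_rV (~` A).
Proof. exact: sigma_algebraC. Qed.

Let rV_bigcup (F : _^nat) : (forall i, g_sigma_preimage coord_rV (F i)) ->
  g_sigma_preimage coord_rV (\bigcup_i (F i)).
Proof. exact: sigma_algebra_bigcup. Qed.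

HB.instance Definition _ := @isMeasurable.Build (measure_rV_display d)
  'rV[T]_n (g_sigma_preimage coord_rV) rV_set0 rV_setC rV_bigcup.

End measurable_rV.

Lemma measurable_coord_rV d (T : measurableType d) n (i : 'I_n) :
  measurable_fun [set: 'rV[T]_n] (coord_rV i).
Proof.
move=> _ Y mY; rewrite setTI; apply: sub_sigma_algebra => /=.
rewrite -bigcup_seq/=; exists i => /=; first by rewrite mem_index_enum.
by exists Y => //; rewrite setTI.
Qed.

Lemma measurable_fun_rVP d1 d2 (T1 : measurableType d1) (T2 : measurableType d2)
    n (f : T1 -> 'rV[T2]_n) :
  (forall i, measurable_fun [set: T1] (fun x => f x ord0 i)) ->
  measurable_fun [set: T1] f.
Proof.
move=> mf _ Y mY.
suff : g_sigma_preimage (@coord_rV _ T2 n) `<=`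
    [set A | measurable ([set: T1] `&` f @^-1` A)] by exact.
apply: smallest_sub.
- split => /=.
  + by rewrite preimage_set0 setI0.
  + move=> A mA; rewrite setTD preimage_setC setTI.
    by apply: measurableC; rewrite -[X in measurable X]setTI.
  + move=> F mF; rewrite preimage_bigcup setI_bigcupr.
    exact: bigcupT_measurable.
- rewrite -bigcup_seq => A [i _ [B mB <-]] /=.
  by rewrite setTI -comp_preimage; exact: mf.
Qed.

Section lebesgue_rV.
Context {R : realType}.

Definition cons_rV d (p : R * 'rV[R]_d) : 'rV[R]_d.+1 :=
  row_mx (p.1)%:M p.2.

Lemma cons_rV0 d (p : R * 'rV[R]_d) : cons_rV p ord0 ord0 = p.1.
Proof.
have -> : ord0 = lshift d ord0 :> 'I_(1 + d) by exact/val_inj.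
by rewrite [LHS](row_mxEl (p.1)%:M) mxE mulr1n.
Qed.

Lemma cons_rVS d (p : R * 'rV[R]_d) (i : 'I_d) :
  cons_rV p ord0 (lift ord0 i) = p.2 ord0 i.
Proof.
have -> : lift ord0 i = rshift 1 i :> 'I_(1 + d) by exact/val_inj.
by rewrite [LHS](row_mxEr (p.1)%:M).
Qed.

Lemma measurable_cons_rV d : measurable_fun setT (@cons_rV d).
Proof.
apply: measurable_fun_rVP => i.
have [->|[j ->]] : i = ord0 \/ exists j, i = lift ord0 j.
  by case: (unliftP ord0 i) => [j|] ->; [right; exists j|left].
- by under eq_fun do rewrite cons_rV0; exact: measurable_fst.
- under eq_fun do rewrite cons_rVS.
  exact: (measurableT_comp (measurable_coord_rV j) measurable_snd).
Qed.

HB.instance Definition _ d := isMeasurableFun.Build _ _ _ _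
  (@cons_rV d) (@measurable_cons_rV d).

Section lebesgue_rV_step.
Local Open Scope ereal_scope.
Context d (mu : {sigma_finite_measure set 'rV[R]_d -> \bar R}).

Definition lebesgue_rV_step : set 'rV[R]_d.+1 -> \bar R :=
  pushforward (@lebesgue_measure R \x mu) (@cons_rV d).

Let step0 : lebesgue_rV_step set0 = 0.
Proof. have mcons := @measurable_cons_rV d; exact: measure0. Qed.

Let step_ge0 A : 0 <= lebesgue_rV_step A.
Proof. have mcons := @measurable_cons_rV d; exact: measure_ge0. Qed.

Let step_sigma_additive : semi_sigma_additive lebesgue_rV_step.
Proof.
have mcons := @measurable_cons_rV d; exact: measure_semi_sigma_additive.
Qed.

HB.instance Definition _ := isMeasure.Build _ _ _ lebesgue_rV_step
  step0 step_ge0 step_sigma_additive.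

Let step_sigma_finite : sigma_finite setT lebesgue_rV_step.
Proof.
have /sigma_finiteP[F [TF ndF Foo]] := sigma_finiteT (@lebesgue_measure R).
have /sigma_finiteP[G [TG ndG Goo]] := sigma_finiteT mu.
pose u (x : 'rV[R]_d.+1) : R * 'rV[R]_d :=
  (x ord0 ord0, \row_i x ord0 (lift ord0 i)).
have mu_ : measurable_fun setT u.
  apply/measurable_fun_pairP; split; first exact: measurable_coord_rV.
  apply: measurable_fun_rVP => i; under eq_fun do rewrite mxE.
  exact: measurable_coord_rV.
have cK : cancel (@cons_rV d) u.
  move=> [a x]; rewrite /u cons_rV0; congr pair.
  by apply/rowP => i; rewrite mxE cons_rVS.
exists (fun n => u @^-1` (F n `*` G n)).
  rewrite -preimage_bigcup (_ : \bigcup_n _ = setT) ?preimage_setT//.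
  rewrite -setXTT TF TG predeqE => -[x y]; split.
    by move=> [n _ []/= ? ?]; split; exists n.
  move=> [/= [n _ Fnx] [k _ Gky]]; exists (maxn n k) => //; split.
  - by move: x Fnx; exact/subsetPset/ndF/leq_maxl.
  - by move: y Gky; exact/subsetPset/ndG/leq_maxr.
move=> n; have [mF Fn] := Foo n; have [mG Gn] := Goo n; split.
  by rewrite -[X in measurable X]setTI; apply: mu_ => //; exact: measurableX.
rewrite /lebesgue_rV_step /pushforward -comp_preimage.
rewrite (_ : u \o _ = id) ?preimage_id; last by apply/funext => p /=; rewrite cK.
by rewrite product_measure1E// lte_mul_pinfty// ge0_fin_numE.
Qed.

HB.instance Definition _ := Measure_isSigmaFinite.Build _ _ _ lebesgue_rV_step
  step_sigma_finite.

End lebesgue_rV_step.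

(* Lebesgue measure on R^d: the d-fold product of lebesgue_measure, carried from
   R * R^d to R^(d+1) by cons_rV; see lebesgue_rV_box. *)
Fixpoint lebesgue_rV d : {sigma_finite_measure set 'rV[R]_d -> \bar R} :=
  match d with
  | 0 => \d_(0 : 'rV[R]_0)
  | d'.+1 => lebesgue_rV_step (lebesgue_rV d')
  end.

Lemma lebesgue_rV_box d (A : 'I_d -> set R) : (forall i, measurable (A i)) ->
  lebesgue_rV d [set x | forall i, A i (x ord0 i)] =
  (\prod_(i < d) lebesgue_measure (A i))%E.
Proof.
elim: d A => [|d IHd] A mA.
  by rewrite big_ord0 /= diracE mem_set// => -[].
pose B := [set x : 'rV[R]_d | forall i, A (lift ord0 i) (x ord0 i)].
have mB : measurable B.
  have -> : B = \bigcap_(i in setT) (coord_rV i @^-1` A (lift ord0 i)).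
    by apply/seteqP; split=> x /= Ax => [i _|i]; [exact: Ax|exact: (Ax i I)].
  apply: fin_bigcap_measurable => // i _.
  by rewrite -[X in measurable X]setTI; exact: measurable_coord_rV.
rewrite big_ord_recl -(IHd (fun i => A (lift ord0 i)))//.
transitivity ((lebesgue_measure \x lebesgue_rV d)%E (A ord0 `*` B)); last first.
  by apply: product_measure1E => //; exact: mA.
rewrite /= /lebesgue_rV_step /pushforward; congr ((_ \x _)%E _).
apply/seteqP; split=> [[a x]|[a x]] /=.
  move=> Ax; split=> [|i]; first by have := Ax ord0; rewrite cons_rV0.
  by have := Ax (lift ord0 i); rewrite cons_rVS.
move=> [Aa Ax] i; case: (unliftP ord0 i) => [j|] ->.
  by rewrite cons_rVS.
by rewrite cons_rV0.
Qed.

End lebesgue_rV.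

Section integration_problem.
Context {R : realType}.

Definition cube d : set 'rV[R]_d := [set x | forall i, 0 <= x ord0 i <= 1].
Arguments cube d _ : clear implicits.

Definition INT d (f : 'rV[R]_d -> R) : R :=
  \int[lebesgue_rV d]_(x in cube d) f x.

(* Functions on [0,1]^d are represented by total functions on R^d, whose values
   outside the cube are never used: the class below does not constrain them and
   neither INT nor an algorithm reads them. Members of the class are Borel on
   the cube, because a convex function on a polytope is upper semicontinuous. *)
Definition F_con d : set ('rV[R]_d -> R) :=
  [set f | (forall x, cube d x -> 0 <= f x <= 1) /\
           convex_function (cube d) f].
Arguments F_con d _ : clear implicits.

(* The node t_(j+1) is an arbitrary function of the j values already computed;
   only the nodes of index j < n are evaluated by [run]. *)
Record algorithm d n := Algorithm {
  node : forall j, j.-tuple R -> 'rV[R]_d ;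
  node_cube : forall j (y : j.-tuple R), cube d (node y) ;
  output : n.-tuple R -> R }.

Fixpoint info d n (A : algorithm d n) (f : 'rV[R]_d -> R) j : j.-tuple R :=
  match j with
  | 0 => [tuple]
  | j'.+1 => let y := info A f j' in [tuple of rcons y (f (node A y))]
  end.

Definition run d n (A : algorithm d n) (f : 'rV[R]_d -> R) : R :=
  output A (info A f n).

Definition worst_case_error d n (F : set ('rV[R]_d -> R)) (A : algorithm d n) :
    \bar R :=
  ereal_sup [set `|INT f - run A f|%:E | f in F].

Definition e_int d n (F : set ('rV[R]_d -> R)) : \bar R :=
  ereal_inf [set worst_case_error F A | A in [set: algorithm d n]].

(* This infimum is a minimum by [n_int_min], except that it is +oo when no n
   is admissible. *)
Definition n_int d (F : set ('rV[R]_d -> R)) (eps : R) : \bar R :=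
  ereal_inf [set n%:R%:E | n in [set n | (e_int n F <= eps%:E)%E]].

Lemma n_int_min d (F : set ('rV[R]_d -> R)) (eps : R) (n : nat) :
  (e_int n F <= eps%:E)%E ->
  exists m, [/\ n_int F eps = m%:R%:E, (e_int m F <= eps%:E)%E &
    forall k, (e_int k F <= eps%:E)%E -> (m <= k)%N].
Proof.
move=> en; have exn : exists k, (e_int k F <= eps%:E)%E by exists n.
case: (ex_minnP exn) => m em mmin; exists m; split=> //.
apply/eqP; rewrite eq_le; apply/andP; split.
  by apply: ereal_inf_lbound; exists m.
by apply: le_ereal_inf_tmp => _ [k /= ek <-]; rewrite lee_fin ler_nat mmin.
Qed.

Definition curse_of_dimensionality (F : forall d, set ('rV[R]_d -> R)) :=
  exists eps c gamma : R, [/\ 0 < eps, 0 < c, 1 < gamma &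
    forall d, (0 < d)%N -> ((c * gamma ^+ d)%:E <= n_int (F d) eps)%E].

End integration_problem.
Arguments cube {R} d _.
Arguments F_con {R} d _.

(* Main.v *)
Require Import Defs.
From mathcomp Require Import all_boot all_order all_algebra.
From mathcomp Require Import all_classical all_reals all_analysis.
From mathcomp Require Import measurable_realfun ring lra.

(** The zero function is compared with one convex function that an algorithm
cannot tell from it.  Run the algorithm on 0, let x_0, ..., x_(n-1) be the nodes
it visits and c = (1/2, ..., 1/2) the centre of the cube.  For a point w of the
cube and a constant delta, the affine function

    y |-> delta + <y - w, w - c> / d                              ([tilt])

equals delta at w, is at most 1 on the cube, and is nonpositive at x_j as soon as
<w - x_j, w - c> >= delta d.  Call w good if this holds for all j.  The supremum
of 0 and of the tilts at all good points ([fooling]) is convex with values in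
[0,1], vanishes at every x_j, and is at least delta on the set of good points.
The algorithm therefore returns the same number for it as for 0, so that its error
is at least delta / 2 times the volume of the good set.

The points that are bad because of x_j form a slight enlargement, inside the cube,
of the ball with diameter [x_j, c]; with such balls Elekes covers the convex hull
of the nodes.  Their volume is exponentially small: for w uniform in the
cube, <w - x_j, w - c> is a sum of d independent bounded terms, each of mean 1/12
whatever x_j is, and delta = 1/500 is far below 1/12.  A Chernoff bound
([lebesgue_bad_set]) gives volume at most (10/11)^d.  Its one-dimensional
ingredient is that, for s = (t - a)(t - 1/2) with a in [0,1] and t uniform in
[0,1], the expectation of exp (2 delta - 2 s) is at most 10/11; this follows from
a quadratic upper bound for exp, which leaves a polynomial to integrate.

Hence the n-th minimal error is at least delta / 2 * (1 - n (10/11)^d), and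
eps0 = delta / 2 yields n >= (11/10)^d (1 - eps / eps0), from which both parts of
the theorem follow. *)

Set Implicit Arguments.
Unset Strict Implicit.
Unset Printing Implicit Defensive.

Import Order.TTheory GRing.Theory Num.Theory.
Import numFieldNormedType.Exports.
Local Open Scope classical_set_scope.
Local Open Scope ring_scope.

(** * One-dimensional estimates *)

(** Multiplied by exp (-y), the claim compares 1 with a function whose derivative
is exp (-y) y (1 - 8 y) / 15: on ]-oo, 1/8] that function is minimal at 0, where it
is 1.  The range reaches as far as 1/8 because the bound is applied to
-2 (t - a)(t - 1/2), whose maximum over the unit square is 1/8. *)
Lemma expR_le_quadratic (R : realType) (y : R) : y <= 1 / 8 ->
  expR y <= 1 + y + 8 / 15 * y ^+ 2.
Proof.
move=> y8.
pose f (x : R) : R := (1 + x + 8 / 15 * x ^+ 2) * expR (- x).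
have df (x : R) : is_derive x 1 f (expR (- x) * (x * (1 / 15 - 8 / 15 * x))).
  rewrite /f; apply: is_derive_eq; rewrite /GRing.scale/=; by field.
have fE (x : R) : derive1 f x = expR (- x) * (x * (1 / 15 - 8 / 15 * x)).
  by rewrite derive1E; apply: derive_val.
have cf (A : set R) : {within A, continuous f}.
  apply: continuous_subspaceT => x.
  by apply: differentiable_continuous; apply/derivable1_diffP; case: (df x).
have f0 : f 0 = 1 by rewrite /f oppr0 expR0 expr0n/= mulr0 !addr0 mulr1.
suff : 1 <= f y by rewrite /f expRN ler_pdivlMr ?expR_gt0// mul1r.
rewrite -f0; have [y0|y0] := leP y 0.
- apply: (@ler0_derive1_le_cc _ f y 0); rewrite ?in_itv/= ?lexx ?y0//.
  + move=> x; rewrite in_itv/= => /andP[_ x0]; rewrite fE.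
    rewrite pmulr_rle0 ?expR_gt0//; nra.
- apply: (@ger0_derive1_le_cc _ f 0 y); rewrite ?in_itv/= ?lexx ?(ltW y0)//.
  + move=> x; rewrite in_itv/= => /andP[x0 xy]; rewrite fE.
    rewrite pmulr_rge0 ?expR_gt0//; nra.
Qed.

(** With s = (t - a)(t - 1/2), the mean of s is 1/12 for every a, and the mean of
s^2 is a convex function of a symmetric about 1/2, hence at most its value 1/30 at
the end points. *)
Lemma integral01_quartic (R : realType) (a : R) : 0 <= a <= 1 ->
  (\int[lebesgue_measure]_(t in `[0%R, 1%R])
    (1 - 2 * ((t - a) * (t - 1 / 2)) + 32 / 15 * ((t - a) * (t - 1 / 2)) ^+ 2)%:E
  <= (5 / 6 + 16 / 225 : R)%:E)%E.
Proof.
move=> /andP[a0 a1].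
pose F (t : R) : R := t - 2 * (t ^+ 3 / 3 - (a + 1 / 2) * t ^+ 2 / 2 + a / 2 * t)
  + 32 / 15 * (t ^+ 5 / 5 - (a + 1 / 2) * t ^+ 4 / 2
    + ((a + 1 / 2) ^+ 2 + a) * t ^+ 3 / 3 - a * (a + 1 / 2) * t ^+ 2 / 2
    + a ^+ 2 * t / 4).
pose f (t : R) : R := 1 - 2 * ((t - a) * (t - 1 / 2))
  + 32 / 15 * ((t - a) * (t - 1 / 2)) ^+ 2.
have dF (t : R) : is_derive t 1 F (f t).
  rewrite /F; apply: is_derive_eq; rewrite /GRing.scale/= /f; by field.
have cF : continuous F.
  move=> x; apply: differentiable_continuous; apply/derivable1_diffP.
  by case: (dF x).
have cf : continuous f.
  move=> x; apply: differentiable_continuous; apply/derivable1_diffP.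
  by rewrite /f; apply: ex_derive.
rewrite (@continuous_FTC2 _ f F) //.
- rewrite -EFinB lee_fin /F; nra.
- by apply: continuous_subspaceT.
- split=> [x _||].
  + by case: (dF x).
  + exact/cvg_at_right_filter/cF.
  + exact/cvg_at_left_filter/cF.
- by move=> x _; rewrite derive1E; apply: derive_val.
Qed.

(** * Integration over R^d *)

(** The integral of a nonnegative function is the supremum of the integrals of the
simple functions below it, whether or not it is measurable.  This allows a
supremum of uncountably many affine functions to be integrated without a proof
that it is measurable. *)
Lemma ge0_le_integral_nonmeasurable d (T : measurableType d) (R : realType)
    (mu : {measure set T -> \bar R}) (D : set T) (f g : T -> \bar R) :
  (forall x, D x -> 0 <= f x)%E -> (forall x, D x -> f x <= g x)%E ->
  (\int[mu]_(x in D) f x <= \int[mu]_(x in D) g x)%E.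
Proof.
move=> f0 fg; rewrite !(integral_mkcond D).
have f0' x : (0 <= (f \_ D) x)%E by apply: erestrict_ge0.
have g0' x : (0 <= (g \_ D) x)%E.
  by apply: erestrict_ge0 => // y Dy; apply: le_trans (fg y Dy); exact: f0.
rewrite !ge0_integralTE//; apply: le_ereal_sup => _ [h hf <-]; exists h => //.
move=> x; apply: (le_trans (hf x)); rewrite !patchE; case: ifPn => // /set_mem.
exact: fg.
Qed.

Section lebesgue_rV_integral.
Context (R : realType).

Lemma measurable_prod_coord_rV d (h : 'I_d -> R -> R) :
  (forall i, measurable_fun setT (h i)) ->
  measurable_fun setT (fun x : 'rV[R]_d => \prod_(i < d) h i (x ord0 i)).
Proof.
move=> mh; apply: measurable_prod => i _.
exact: (measurableT_comp (mh i) (measurable_coord_rV i)).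
Qed.

(** Tonelli's theorem, one coordinate at a time. *)
Lemma integral_lebesgue_rV_prod d (h : 'I_d -> R -> R) :
  (forall i, measurable_fun setT (h i)) -> (forall i t, 0 <= h i t) ->
  (\int[lebesgue_rV d]_x (\prod_(i < d) h i (x ord0 i))%:E =
   \prod_(i < d) \int[lebesgue_measure]_t (h i t)%:E)%E.
Proof.
elim: d h => [|d IH] h mh h0.
  under eq_integral do rewrite big_ord0.
  by rewrite big_ord0 integral_cst//= diracT mule1.
have prod0 k (u : 'I_k -> R -> R) : (forall i t, 0 <= u i t) ->
    forall x : 'rV[R]_k, 0 <= \prod_(i < k) u i (x ord0 i).
  by move=> u0 x; apply: prodr_ge0.
have mH := measurable_prod_coord_rV mh.
pose h' i := h (lift ord0 i).
have mh' i : measurable_fun setT (h' i) by exact: mh.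
have h'0 i t : 0 <= h' i t by exact: h0.
have mH' := measurable_prod_coord_rV mh'.
rewrite big_ord_recl /= -/(h' _) -(IH h')//.
rewrite /lebesgue_rV_step ge0_integral_pushforward//=; last 3 first.
- exact: measurable_cons_rV.
- by apply/measurable_EFinP; exact: mH.
- by move=> x _; rewrite lee_fin prod0.
rewrite preimage_setT fubini_tonelli1//=; last 2 first.
- apply/measurable_EFinP; apply: (measurableT_comp mH).
  exact: measurable_cons_rV.
- by move=> x; rewrite lee_fin prod0.
rewrite /fubini_F -ge0_integralZr//; last 3 first.
- by apply/measurable_EFinP; exact: mh.
- by move=> t _; rewrite lee_fin.
- by apply: integral_ge0 => x _; rewrite lee_fin prod0.
apply: eq_integral => a _; rewrite -ge0_integralZl//; last 3 first.
- by apply/measurable_EFinP; exact: mH'.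
- by move=> x _; rewrite lee_fin prod0.
- by rewrite lee_fin.
apply: eq_integral => x _; rewrite big_ord_recl cons_rV0 EFinM/=.
congr (_ * _%:E)%E; apply: eq_bigr => i _; exact: (congr1 _ (cons_rVS _ _)).
Qed.

End lebesgue_rV_integral.

(** * Volume of the points that one node makes bad *)

Section bad_points.
Context (R : realType).

(** The scalar product <w - x, w - c> with c the centre of the cube; it is negative
exactly when w lies inside the ball with diameter [x, c]. *)
Definition excess d (x w : 'rV[R]_d) : R :=
  \sum_(i < d) (w ord0 i - x ord0 i) * (w ord0 i - 1 / 2).

(** The constant delta.  It must be so small that exp (2 delta) times the integral
407/450 of the quadratic factor stays below 10/11. *)
Definition margin : R := 1 / 500.

(** For a and t in [0,1], a majorant of exp (2 delta - 2 s), where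
s = (t - a)(t - 1/2) is the contribution of one coordinate to the excess. *)
Definition chernoff_factor (a t : R) : R := expR (2 * margin) *
  (1 - 2 * ((t - a) * (t - 1 / 2)) + 32 / 15 * ((t - a) * (t - 1 / 2)) ^+ 2).

Lemma quadratic_factor_ge0 (s : R) : 0 <= 1 - 2 * s + 32 / 15 * s ^+ 2.
Proof. have := sqr_ge0 (s - 15 / 32); nra. Qed.

Lemma chernoff_factor_ge0 a t : 0 <= chernoff_factor a t.
Proof. apply: mulr_ge0; [exact: expR_ge0|exact: quadratic_factor_ge0]. Qed.

Lemma expR_le_chernoff_factor a t : 0 <= a <= 1 -> 0 <= t <= 1 ->
  expR (2 * margin - 2 * ((t - a) * (t - 1 / 2))) <= chernoff_factor a t.
Proof.
move=> /andP[a0 a1] /andP[t0 t1]; rewrite expRD ler_wpM2l ?expR_ge0//.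
apply: le_trans (expR_le_quadratic _) _;
  last by rewrite le_eqVlt; apply/orP; left; apply/eqP; field.
(* s is affine in a, so that its minimum is attained at a = 1 or a = 0. *)
have [th|/ltW th] := leP (1 / 2) t.
- have p : 0 <= (1 - a) * (t - 1 / 2) by apply: mulr_ge0; lra.
  have := sqr_ge0 (t - 3 / 4); nra.
- have p : 0 <= a * (1 / 2 - t) by apply: mulr_ge0; lra.
  have := sqr_ge0 (t - 1 / 4); nra.
Qed.

Lemma measurable_chernoff_factor a : measurable_fun setT (chernoff_factor a).
Proof.
apply: continuous_measurable_fun => t.
apply: differentiable_continuous; apply/derivable1_diffP.
by rewrite /chernoff_factor; apply: ex_derive.
Qed.

Lemma integral_chernoff_factor a : 0 <= a <= 1 ->
  (\int[lebesgue_measure]_t (chernoff_factor a t * \1_`[0%R, 1%R] t)%:E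
    <= (10 / 11 : R)%:E)%E.
Proof.
move=> a01.
have e0 := expR_ge0 (2 * margin).
rewrite (_ : (\int[_]_t _)%E = (\int[lebesgue_measure]_(t in `[0%R, 1%R])
  ((expR (2 * margin))%:E * (1 - 2 * ((t - a) * (t - 1 / 2))
     + 32 / 15 * ((t - a) * (t - 1 / 2)) ^+ 2)%:E))%E); last first.
  rewrite [RHS]integral_mkcond; apply: eq_integral => t _.
  rewrite patchE indicE; case: (t \in _); first by rewrite mulr1.
  by rewrite mulr0.
rewrite ge0_integralZl_EFin//; last 2 first.
- by move=> t _; rewrite lee_fin quadratic_factor_ge0.
- apply/measurable_EFinP; apply: measurable_funTS.
  apply: continuous_measurable_fun => t.
  apply: differentiable_continuous; apply/derivable1_diffP.
  exact: ex_derive.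
apply: le_trans (lee_wpmul2l _ (integral01_quartic a01)) _.
  by rewrite lee_fin.
rewrite -EFinM lee_fin.
have : (1 - 2 * margin) * expR (2 * margin) <= 1.
  by rewrite -ler_pdivlMr ?expR_gt0// div1r -expRN expR_ge1Dx.
rewrite /margin; lra.
Qed.

Lemma measurable_excess d (x : 'rV[R]_d) : measurable_fun setT (excess x).
Proof.
apply: measurable_sum => i.
have mi : measurable_fun setT (fun w : 'rV[R]_d => w ord0 i).
  exact: measurable_coord_rV.
by apply: measurable_funM; apply: measurable_funB.
Qed.

Lemma cubeE d : cube d = [set x : 'rV[R]_d | forall i, `[0, 1]%classic (x ord0 i)].
Proof.
by apply/seteqP; split=> x /= cx i; have := cx i; rewrite /= in_itv.
Qed.

Lemma measurable_cube d : measurable (cube d : set 'rV[R]_d).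
Proof.
rewrite cubeE (_ : [set _ | _] = \bigcap_(i in [set: 'I_d])
    (coord_rV i @^-1` (`[0%R, 1%R]%classic : set R))); last first.
  by apply/seteqP; split=> x /= cx i => [_|]; exact: cx.
apply: fin_bigcap_measurable => // i _.
by rewrite -[X in measurable X]setTI; exact: measurable_coord_rV.
Qed.

Lemma lebesgue_rV_cube d : lebesgue_rV d (cube d : set 'rV[R]_d) = 1%E.
Proof.
rewrite cubeE (@lebesgue_rV_box _ _ (fun=> `[0%R, 1%R]%classic))//= big1// => i _.
by rewrite lebesgue_measure_itv/= lte_fin ltr01 oppr0 adde0.
Qed.

Definition bad_set d (x : 'rV[R]_d) : set 'rV[R]_d :=
  [set w | cube d w /\ excess x w < margin * d%:R].

Lemma measurable_bad_set d (x : 'rV[R]_d) : measurable (bad_set x).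
Proof.
have -> : bad_set x =
    cube d `&` excess x @^-1` (`]-oo, margin * d%:R[%classic : set R).
  by apply/seteqP; split=> w /=; rewrite in_itv.
apply: measurableI; first exact: measurable_cube.
by rewrite -[X in measurable X]setTI; exact: measurable_excess.
Qed.

(** Chernoff's bound: a bad w satisfies exp (2 delta d - 2 <w - x, w - c>) >= 1, and
this exponential is a product of functions of single coordinates, each majorised
by a [chernoff_factor] whose integral is at most 10/11. *)
Lemma lebesgue_bad_set d (x : 'rV[R]_d) : cube d x ->
  (lebesgue_rV d (bad_set x) <= ((10 / 11) ^+ d)%:E)%E.
Proof.
move=> cx.
pose h i (t : R) := chernoff_factor (x ord0 i) t * \1_`[0%R, 1%R] t.
have h0 i t : 0 <= h i t by rewrite mulr_ge0// chernoff_factor_ge0.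
have mh i : measurable_fun setT (h i).
  by apply: measurable_funM => //; exact: measurable_chernoff_factor.
rewrite -[bad_set x]setIT -integral_indic//; last exact: measurable_bad_set.
apply: (@le_trans _ _ (\int[lebesgue_rV d]_w (\prod_(i < d) h i (w ord0 i))%:E)%E).
  apply: ge0_le_integral_nonmeasurable => [w _|w _]; first by rewrite lee_fin.
  rewrite lee_fin indicE; case: (boolP (_ \in _)) => [|_]; last exact: prodr_ge0.
  rewrite inE => -[cw xw] /=.
  apply: (@le_trans _ _ (\prod_(i < d) expR (2 * margin -
      2 * ((w ord0 i - x ord0 i) * (w ord0 i - 1 / 2))))).
    rewrite -expR_sum -[leLHS]expR0 ler_expR sumrB sumr_const card_ord.
    rewrite -mulr_sumr -/(excess x w) -mulr_natr; lra.
  apply: ler_prod => i _; rewrite expR_ge0/= /h indicE mem_set ?mulr1.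
    by apply: expR_le_chernoff_factor; [exact: cx|exact: cw].
  by rewrite /= in_itv/=; exact: cw.
rewrite integral_lebesgue_rV_prod//.
rewrite -[X in _ ^+ X](card_ord d) -prodr_const -prodEFin.
have : (0 <= \prod_(i < d) \int[lebesgue_measure]_t (h i t)%:E <=
    \prod_(i < d) (10 / 11 : R)%:E)%E.
  elim/big_ind2: _ => [|x1 x2 y1 y2 /andP[? ?] /andP[? ?]|i _].
  - by rewrite lexx lee01.
  - by rewrite mule_ge0//= lee_pmul.
  - rewrite integral_chernoff_factor ?andbT; last exact: cx.
    by apply: integral_ge0 => t _; rewrite lee_fin.
by case/andP.
Qed.

End bad_points.

(** * The fooling function *)

Section fooling_function.
Context (R : realType) (d n : nat) (x : nat -> 'rV[R]_d).
Hypotheses (d_gt0 : (0 < d)%N) (x_cube : forall j, cube d (x j)).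

Definition good_set : set 'rV[R]_d :=
  [set w | cube d w /\ forall j, (j < n)%N -> margin R * d%:R <= excess (x j) w].

(** This is delta + <y - w, w - c> / d, because excess y w = <w - y, w - c>. *)
Definition tilt (w y : 'rV[R]_d) : R := margin R - excess y w / d%:R.

(** The value 0 keeps the supremum nonnegative where all tilts are negative. *)
Definition fooling_values (y : 'rV[R]_d) : set R :=
  0 |` [set tilt w y | w in good_set].

Definition fooling (y : 'rV[R]_d) : R := sup (fooling_values y).

Lemma tilt_le1 w y : cube d w -> cube d y -> tilt w y <= 1.
Proof.
move=> cw cy; have d0 : 0 < d%:R :> R by rewrite ltr0n.
(* A coordinate contributes (w_i - y_i)(w_i - 1/2), at least -1/2. *)
suff : - (1 / 2) * d%:R <= excess y w.
  rewrite -ler_pdivlMr// /tilt /margin; lra.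
rewrite -[X in _ * X%:R](card_ord d) mulr_natr -sumr_const.
apply: ler_sum => i _; have /andP[w0 w1] := cw i; have /andP[y0 y1] := cy i.
nra.
Qed.

Lemma tilt_affine w y z t :
  tilt w (t *: y + (1 - t) *: z) = t * tilt w y + (1 - t) * tilt w z.
Proof.
rewrite /tilt (_ : excess _ w = t * excess y w + (1 - t) * excess z w).
  by ring.
rewrite /excess !mulr_sumr -big_split/=; apply: eq_bigr => i _.
by rewrite !mxE; ring.
Qed.

Lemma has_sup_fooling_values y : cube d y -> has_sup (fooling_values y).
Proof.
move=> cy; split; first by exists 0; left.
by exists 1 => _ [->//|[w [cw _] <-]]; exact: tilt_le1.
Qed.

Lemma fooling_ge0 y : cube d y -> 0 <= fooling y.
Proof.
by move=> /has_sup_fooling_values[_ hy]; apply: ub_le_sup => //; left.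
Qed.

Lemma fooling_ge_tilt w y : cube d y -> good_set w -> tilt w y <= fooling y.
Proof.
move=> /has_sup_fooling_values[_ hy] gw.
by apply: ub_le_sup => //; right; exists w.
Qed.

Lemma fooling_le y r : 0 <= r -> (forall w, good_set w -> tilt w y <= r) ->
  fooling y <= r.
Proof.
move=> r0 tr; apply: ge_sup; first by exists 0; left.
by move=> _ [->//|[w gw <-]]; exact: tr.
Qed.

Lemma fooling_le1 y : cube d y -> fooling y <= 1.
Proof.
by move=> cy; apply: fooling_le => // w [cw _]; exact: tilt_le1.
Qed.

Lemma fooling_node j : (j < n)%N -> fooling (x j) = 0.
Proof.
move=> jn; apply/eqP; rewrite eq_le fooling_ge0// andbT.
apply: fooling_le => // w [_ /(_ j jn)].
by rewrite -ler_pdivlMr ?ltr0n// /tilt subr_le0.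
Qed.

Lemma fooling_good w : good_set w -> margin R <= fooling w.
Proof.
move=> gw; apply: le_trans (fooling_ge_tilt (proj1 gw) gw).
rewrite /tilt /excess big1 ?mul0r ?subr0// => i _.
by rewrite subrr mul0r.
Qed.

Lemma fooling_F_con : F_con d fooling.
Proof.
split=> [y cy|t y z]; first by rewrite fooling_ge0// fooling_le1.
rewrite !inE => cy cz.
have t0 : 0 <= t%:num by [].
have t1 : t%:num <= 1 by [].
apply: fooling_le => [|w gw].
  apply: addr_ge0; apply: mulr_ge0 => //; try exact: fooling_ge0.
  by rewrite /= subr_ge0.
(* Unfold both barycentres: a tilt is affine and the fooling function is above it. *)
change (tilt w (t%:num *: y + (1 - t%:num) *: z)
  <= t%:num * fooling y + (1 - t%:num) * fooling z).
rewrite tilt_affine.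
by apply: lerD; apply: ler_wpM2l; rewrite ?subr_ge0//; apply: fooling_ge_tilt.
Qed.

Lemma measurable_good_set : measurable good_set.
Proof.
have -> : good_set = cube d `\` \big[setU/set0]_(k < n) bad_set (x k).
  rewrite -(bigcup_mkord n (fun k => bad_set (x k))).
  apply/seteqP; split=> w /= [cw].
    move=> gw; split=> // -[j /= jn [_]].
    by rewrite ltNge gw.
  move=> bw; split=> // j jn; rewrite leNgt.
  by apply/negP => jw; apply: bw; exists j.
apply: measurableD; first exact: measurable_cube.
by apply: bigsetU_measurable => k _; exact: measurable_bad_set.
Qed.

Lemma lebesgue_good_set :
  ((1 - n%:R * (10 / 11) ^+ d)%:E <= lebesgue_rV d good_set)%E.
Proof.
(* The n bad sets, followed by the good set at index n, cover the cube. *)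
pose F k := if (k < n)%N then bad_set (x k) else good_set.
have Fn : F n = good_set by rewrite /F ltnn.
have mF k : measurable (F k).
  rewrite /F; case: ifP => _; first exact: measurable_bad_set.
  exact: measurable_good_set.
have cF : cube d `<=` \big[setU/set0]_(k < n.+1) F k.
  move=> w cw; rewrite -bigcup_mkord.
  have [gw|] := pselect (good_set w); first by exists n; [exact: ltnSn|rewrite Fn].
  move=> /not_andP[//|/existsNP[j /not_implyP[jn /negP]]]; rewrite -ltNge => jw.
  by exists j; [exact: ltnW|rewrite /F jn].
have : (lebesgue_rV d (cube d) <=
    \sum_(k < n) lebesgue_rV d (F k) + lebesgue_rV d good_set)%E.
  have := content_subadditive (lebesgue_rV d) (fun k _ => mF k)
    (@measurable_cube R d) cF.
  by rewrite big_ord_recr/= Fn.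
rewrite lebesgue_rV_cube => h.
rewrite EFinB leeBlDl//.
apply: le_trans h _; rewrite leeD2r//.
apply: (@le_trans _ _ (\sum_(k < n) ((10 / 11 : R) ^+ d)%:E)%E).
  by apply: lee_sum => k _; rewrite /F ltn_ord; exact: (lebesgue_bad_set (x_cube k)).
by rewrite sumEFin lee_fin sumr_const card_ord -[leLHS]mulr_natl.
Qed.

Lemma INT_fooling : margin R * (1 - n%:R * (10 / 11) ^+ d) <= INT fooling.
Proof.
have m0 : 0 <= margin R by rewrite /margin; lra.
have mc := @measurable_cube R d.
have le1 : (\int[lebesgue_rV d]_(y in cube d) (fooling y)%:E <= 1)%E.
  have int1 : (\int[lebesgue_rV d]_(y in cube d) cst (1%:E : \bar R) y = 1)%E.
    by rewrite integral_cst// mul1e; exact: lebesgue_rV_cube.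
  rewrite -[leRHS]int1.
  apply: ge0_le_integral_nonmeasurable => y cy; rewrite lee_fin.
    exact: fooling_ge0.
  exact: fooling_le1.
have ge0 : (0 <= \int[lebesgue_rV d]_(y in cube d) (fooling y)%:E)%E.
  by apply: integral_ge0 => y cy; rewrite lee_fin fooling_ge0.
rewrite /INT /Rintegral -lee_fin fineK; last first.
  by rewrite ge0_fin_numE// (le_lt_trans le1)// ltry.
apply: (@le_trans _ _
    (\int[lebesgue_rV d]_(y in cube d) ((margin R)%:E * (\1_good_set y)%:E))%E).
  rewrite ge0_integralZl_EFin//; last first.
    by apply/measurable_EFinP; apply: measurable_indic; exact: measurable_good_set.
  rewrite integral_indic//; last exact: measurable_good_set.
  rewrite setIidl; last by move=> w [].
  by rewrite EFinM lee_wpmul2l ?lee_fin// lebesgue_good_set.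
apply: ge0_le_integral_nonmeasurable => y cy.
  by rewrite mule_ge0// lee_fin.
rewrite -EFinM lee_fin indicE; case: (boolP (y \in good_set)) => [|_].
  by rewrite inE mulr1; exact: fooling_good.
by rewrite mulr0 fooling_ge0.
Qed.

End fooling_function.

(** * Lower bounds for algorithms *)

Section lower_bound.
Context (R : realType).

(** Nodes are chosen from the values already seen, so two functions that agree at
the nodes visited for one of them produce the same information, hence the same
nodes, for both. *)
Lemma info_eq d n (A : algorithm (R := R) d n) (f g : 'rV[R]_d -> R) :
  (forall j, (j < n)%N -> f (node A (info A g j)) = g (node A (info A g j))) ->
  forall j, (j <= n)%N -> info A f j = info A g j.
Proof.
move=> fg; elim=> [//|j IH] jn /=.
by rewrite (IH (ltnW jn)) fg.
Qed.

Lemma cst0_F_con d : F_con d (fun=> 0 : R).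
Proof.
split=> [y _|t y z _ _]; first by rewrite lexx ler01.
by rewrite convmm.
Qed.

(** The output r is the same for 0 and for the fooling function g, and the larger of
|r| and |INT g - r| is at least INT g / 2. *)
Lemma worst_case_error_ge d n (A : algorithm (R := R) d n) : (0 < d)%N ->
  ((margin R / 2 * (1 - n%:R * (10 / 11) ^+ d))%:E
    <= worst_case_error (F_con d) A)%E.
Proof.
move=> d0.
pose x j := node A (info A (fun=> 0) j).
have xc j : cube d (x j) by exact: node_cube.
pose g := fooling n x.
have runE : run A g = run A (fun=> 0).
  by rewrite /run (info_eq (g := fun=> 0))// => j jn; rewrite /g fooling_node.
have Ig : margin R * (1 - n%:R * (10 / 11) ^+ d) <= INT g by exact: INT_fooling.
have I0 : INT ((fun=> 0) : 'rV[R]_d -> R) = 0 by exact: (congr1 fine (integral0 _ _)).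
have errg : (`|INT g - run A g|%:E <= worst_case_error (F_con d) A)%E.
  by apply: ereal_sup_ubound; exists g => //; exact: fooling_F_con.
have err0 : (`|0 - run A g|%:E <= worst_case_error (F_con d) A)%E.
  rewrite runE -[X in `|X - _|]I0.
  by apply: ereal_sup_ubound; exists (fun=> 0) => //; exact: cst0_F_con.
have [r0|r0] := leP (margin R / 2 * (1 - n%:R * (10 / 11) ^+ d)) (run A g).
  apply: le_trans err0; rewrite lee_fin sub0r normrN.
  exact: le_trans (ler_norm _).
apply: le_trans errg; rewrite lee_fin; apply: le_trans (ler_norm _); lra.
Qed.

Lemma n_int_F_con_ge (d : nat) (eps : R) : (0 < d)%N ->
  (((11 / 10) ^+ d * (1 - eps / (margin R / 2)))%:E <= n_int (F_con d) eps)%E.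
Proof.
move=> d0; apply: le_ereal_inf_tmp => _ [n /= en <-]; rewrite lee_fin.
have : ((margin R / 2 * (1 - n%:R * (10 / 11) ^+ d))%:E <= eps%:E)%E.
  apply: le_trans en; apply: le_ereal_inf_tmp => _ [A _ <-].
  exact: worst_case_error_ge.
have m0 : 0 < margin R / 2 by rewrite /margin; lra.
rewrite lee_fin mulrC -ler_pdivlMr// => h.
have p0 : 0 <= (11 / 10 : R) ^+ d by apply: exprn_ge0; lra.
have pq : (11 / 10 : R) ^+ d * (10 / 11) ^+ d = 1.
  by rewrite -exprMn (_ : 11 / 10 * _ = 1) ?expr1n//; field.
apply: (@le_trans _ _ ((11 / 10) ^+ d * (n%:R * (10 / 11) ^+ d))).
  by apply: ler_wpM2l => //; lra.
by rewrite mulrCA pq mulr1.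
Qed.

End lower_bound.

Theorem theorem2 (R : realType) :
  (exists eps0 : R, 0 < eps0 < 1 / 2 /\
    forall (eps : R) (d : nat), 0 < eps < eps0 -> (0 < d)%N ->
      (((1 / (d%:R + 1)) * (11 / 10) ^+ d * (1 - eps / eps0))%:E
        <= n_int (F_con d) eps)%E) /\
  curse_of_dimensionality (@F_con R).
Proof.
have m0 : 0 < margin R / 2 by rewrite /margin; lra.
split.
  exists (margin R / 2); split; first by rewrite m0 /margin; lra.
  move=> eps d /andP[e0 e1] d0; apply: le_trans (n_int_F_con_ge eps d0).
  rewrite lee_fin -mulrA ler_piMl//.
    apply: mulr_ge0; first by apply: exprn_ge0; lra.
    by rewrite subr_ge0 ler_pdivrMr// mul1r ltW.
  by rewrite ler_pdivrMr ?mul1r ?lerDr// ltr_wpDl.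
exists (margin R / 4), (1 / 2), (11 / 10); split; [rewrite /margin; lra|lra|lra|].
move=> d d0; apply: le_trans (n_int_F_con_ge _ d0).
by rewrite lee_fin mulrC le_eqVlt; apply/orP; left; apply/eqP; rewrite /margin; field.
Qed.
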